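(* Let $\mathcal{H}$ and $\mathcal{K}$ be real Hilbert spaces, let $b \in \mathcal{K}$, let $T \in \mathcal{B}(\mathcal{H},\mathcal{K})$ be a nonzero bounded linear operator with closed range, and let $\mathrm{Prox}\colon \mathcal{K} \to \mathcal{K}$ be a proximity operator on $\mathcal{K}$. Then the operator $A\colon \mathcal{H}_T \to \mathcal{H}_T$, $A(x) := T^\dagger\, \mathrm{Prox}(Tx + b)$, is a proximity operator on $\mathcal{H}_T$.
   Context: $\mathcal{B}(\mathcal{H},\mathcal{K})$ denotes the bounded linear operators from $\mathcal{H}$ to $\mathcal{K}$, with operator norm $\|\cdot\|_{\mathcal{B}(\mathcal{H},\mathcal{K})}$; $\mathcal{N}(T)$ and $\mathcal{R}(T)$ are the kernel and range of $T$; $P_C$ is the orthogonal projection onto a closed convex set $C$. $T^\dagger \in \mathcal{B}(\mathcal{K},\mathcal{H})$ is the Moore-Penrose inverse of $T$, given pointwise by $\{T^\dagger y\} = \{x \in \mathcal{H} : T^*Tx = T^*y\} \cap \mathcal{R}(T^* )$. $\mathcal{H}_T$ denotes the linear space $\mathcal{H}$ equipped with the inner product $$\langle x,y\rangle_{\mathcal{H}_T} = \frac{\langle Tx,Ty\rangle_{\mathcal{K}}}{\|T\|^2_{\mathcal{B}(\mathcal{H},\mathcal{K})}} + \langle x, P_{\mathcal{N}(T)}y\rangle_{\mathcal{H}},$$ whose norm is equivalent to the norm of $\mathcal{H}$ (as $T$ has closed range), so that $\mathcal{H}_T$ is a Hilbert space. For a real Hilbert space $\mathcal{X}$ with norm $\|\cdot\|_{\mathcal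 X}$, $\Gamma_0(\mathcal{X})$ is the set of proper, convex, lower semi-continuous functions $f\colon\mathcal{X} \to (-\infty,\infty]$, and for $f\in\Gamma_0(\mathcal{X})$ one sets $\mathrm{prox}_f(x) = \operatorname{argmin}_{y\in\mathcal{X}}\{\tfrac12\|x-y\|_{\mathcal{X}}^2 + f(y)\}$ (the unique minimizer). A map $\mathcal{X}\to\mathcal{X}$ is called a proximity operator on $\mathcal{X}$ if it equals $\mathrm{prox}_f$ for some $f\in\Gamma_0(\mathcal{X})$. *)

(* Defs.v *)
From HB Require Import structures.
From mathcomp Require Import all_boot all_order all_algebra.
From mathcomp Require Import ring lra.
From mathcomp Require Import boolp classical_sets functions reals
  constructive_ereal topology normedtype.

Set Implicit Arguments.
Unset Strict Implicit.
Unset Printing Implicit Defensive.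

Import Order.TTheory GRing.Theory Num.Theory.
Import numFieldNormedType.Exports.

Local Open Scope classical_set_scope.
Local Open Scope ring_scope.

HB.mixin Record NormedModule_hasInner (R : realType) (V : Type)
    & NormedModule R V := {
  inner : V -> V -> R;
  innerC : forall x y, inner x y = inner y x;
  innerDl : forall x y z, inner (x + y) z = inner x z + inner y z;
  innerZl : forall (a : R) x y, inner (a *: x) y = a * inner x y;
  innerxx : forall x, inner x x = `|x| ^+ 2
}.

#[short(type="preHilbertType")]
HB.structure Definition PreHilbert (R : realType) :=
  {V of NormedModule R V & NormedModule_hasInner R V}.

#[short(type="hilbertType")]
HB.structure Definition Hilbert (R : realType) :=
  {V of PreHilbert R V & Complete V}.

(* A module with a positive definite symmetric bilinear form, normed by
   `|x| = sqrt (form x x). *)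
HB.factory Record Lmodule_hasInner (R : realType) (V : Type)
    & GRing.Lmodule R V := {
  form : V -> V -> R;
  formC : forall x y, form x y = form y x;
  formDl : forall x y z, form (x + y) z = form x z + form y z;
  formZl : forall (a : R) x y, form (a *: x) y = a * form x y;
  form_ge0 : forall x, 0 <= form x x;
  form_eq0 : forall x, form x x = 0 -> x = 0
}.

HB.builders Context R V & Lmodule_hasInner R V.

Let formDr x y z : form x (y + z) = form x y + form x z.
Proof. by rewrite formC formDl (formC y) (formC z). Qed.

Let formZr a x y : form x (a *: y) = a * form x y.
Proof. by rewrite formC formZl formC. Qed.

Let nrm (x : V) : R := Num.sqrt (form x x).

Let sqr_nrm x : nrm x ^+ 2 = form x x.
Proof. by rewrite sqr_sqrtr// form_ge0. Qed.

Let CS x y : form x y <= nrm x * nrm y.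
Proof.
have [y0|y0] := eqVneq (form y y) 0.
  rewrite (form_eq0 y0) -(scale0r x) formZr mul0r mulr_ge0// sqrtr_ge0//.
have yp : 0 < form y y by rewrite lt_neqAle eq_sym y0 form_ge0.
apply: (@le_trans _ _ `|form x y|); first exact: ler_norm.
rewrite -(@ler_pXn2r _ 2)// ?nnegrE ?mulr_ge0 ?sqrtr_ge0//.
rewrite exprMn !sqr_nrm real_normK ?num_real//.
have := form_ge0 (form y y *: x + (- form x y) *: y).
rewrite formDl !formDr !formZl !formZr (formC y x).
set a := form x x; set b := form y y; set c := form x y => H.
have : 0 <= b * (a * b - c ^+ 2) by move: H; rewrite -/b; lra.
by rewrite pmulr_rge0// subr_ge0.
Qed.

Let ler_nrmD x y : nrm (x + y) <= nrm x + nrm y.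
Proof.
rewrite -(@ler_pXn2r _ 2)// ?nnegrE ?addr_ge0 ?sqrtr_ge0//.
rewrite sqrrD !sqr_nrm formDl !formDr (formC y x).
by have := CS x y; lra.
Qed.

Let nrmZ a x : nrm (a *: x) = `|a| * nrm x.
Proof.
by rewrite /nrm formZl formZr mulrA -expr2 sqrtrM ?sqr_ge0// sqrtr_sqr.
Qed.

Let nrm_eq0 x : nrm x = 0 -> x = 0.
Proof. by move=> x0; apply: form_eq0; rewrite -sqr_nrm x0 expr0n. Qed.

HB.instance Definition _ := Lmodule_isNormed.Build R V ler_nrmD nrmZ nrm_eq0.

Let formxx (x : V) : form x x = `|x| ^+ 2.
Proof. by rewrite -sqr_nrm. Qed.

HB.instance Definition _ :=
  NormedModule_hasInner.Build R V formC formDl formZl formxx.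

HB.end.

Section inner_theory.
Context {R : realType} {V : preHilbertType R}.
Implicit Types x y z : V.

Lemma innerDr x y z : inner x (y + z) = inner x y + inner x z.
Proof. by rewrite innerC innerDl (innerC y) (innerC z). Qed.

Lemma innerZr (a : R) x y : inner x (a *: y) = a * inner x y.
Proof. by rewrite innerC innerZl innerC. Qed.

Lemma innerNl x y : inner (- x) y = - inner x y.
Proof. by rewrite -scaleN1r innerZl mulN1r. Qed.

Lemma innerNr x y : inner x (- y) = - inner x y.
Proof. by rewrite innerC innerNl innerC. Qed.

Lemma inner0l x : inner 0 x = 0.
Proof. by rewrite -(scale0r (0 : V)) innerZl mul0r. Qed.

Lemma inner0r x : inner x 0 = 0.
Proof. by rewrite innerC inner0l. Qed.

Lemma inner_ge0 x : 0 <= inner x x.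
Proof. by rewrite innerxx exprn_ge0. Qed.

Lemma inner_eq0 x : inner x x = 0 -> x = 0.
Proof. by rewrite innerxx => /eqP; rewrite expf_eq0 /= normr_eq0 => /eqP. Qed.

Definition innerE :=
  (@innerDl R V, innerDr, @innerZl R V, innerZr, innerNl, innerNr).

Lemma cauchy_schwarz x y : `|inner x y| <= `|x| * `|y|.
Proof.
have CS (u v : V) : inner u v <= `|u| * `|v|.
  have : `|u + v| ^+ 2 <= (`|u| + `|v|) ^+ 2.
    by rewrite ler_pXn2r ?nnegrE ?addr_ge0// ler_normD.
  by rewrite sqrrD -!innerxx !innerE (innerC v u); lra.
by rewrite ler_norml CS andbT lerNl -innerNl -(normrN x) CS.
Qed.

Lemma parallelogram x y z :
  `|x - y| ^+ 2 = 2 * `|z - x| ^+ 2 + 2 * `|z - y| ^+ 2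
                  - 4 * `|z - 2^-1 *: (x + y)| ^+ 2.
Proof.
rewrite -!innerxx !innerE (innerC y x) (innerC x z) (innerC y z).
by field.
Qed.

End inner_theory.

Definition convex_subset {R : realType} {V : lmodType R} (C : set V) :=
  forall x y (t : R), C x -> C y -> 0 <= t <= 1 -> C (t *: x + (1 - t) *: y).

Definition kernel {R : realType} {V W : lmodType R} (T : V -> W) : set V :=
  [set x | T x = 0].

(* The orthogonal projection P_C, when C is closed, convex and nonempty. *)
Definition proj {R : realType} {V : normedModType R} (C : set V) (x : V) : V :=
  xget 0 [set p | C p /\ forall z, C z -> `|x - p| <= `|x - z|].

Section projection.
Context {R : realType} {V : hilbertType R}.

Lemma proj_exists (C : set V) (x : V) : closed C -> convex_subset C ->
  C !=set0 -> exists p, C p /\ forall z, C z -> `|x - p| <= `|x - z|.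
Proof.
move=> Ccl Ccvx [c Cc].
pose D := [set `|x - z| ^+ 2 | z in C].
have Dinf : has_inf D.
  split; first by exists (`|x - c| ^+ 2), c.
  by exists 0 => _ [z _ <-]; rewrite exprn_ge0.
pose d := inf D.
have dle z : C z -> d <= `|x - z| ^+ 2.
  by move=> Cz; apply: ge_inf; [case: Dinf|exists z].
pose B (e : R) := [set z | C z /\ `|x - z| ^+ 2 < d + e].
have Bne e : 0 < e -> B e !=set0.
  move=> e0; have [_ [z Cz <-] zd] := inf_adherent e0 Dinf.
  by exists z; split.
pose F := filter_from [set e : R | 0 < e] B.
have FF : ProperFilter F.
  apply: filter_from_proper; last exact: Bne.
  apply: filter_from_filter.
    by exists 1 => /=.
  move=> a b /= a0 b0; exists (Num.min a b); first by rewrite lt_min a0.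
  move=> z [Cz zm]; split; split => //; apply: (lt_le_trans zm);
    by rewrite lerD2l ge_min lexx ?orbT.
have Bclose e z w : B e z -> B e w -> `|z - w| ^+ 2 <= 4 * e.
  move=> [Cz zd] [Cw wd]; rewrite (parallelogram z w x).
  have := dle (2^-1 *: (z + w)).
  suff Cm : C (2^-1 *: (z + w)) by move=> /(_ Cm); lra.
  have := Ccvx z w 2^-1 Cz Cw; rewrite scalerDr.
  have -> : 1 - 2^-1 = 2^-1 :> R by field.
  by apply; apply/andP; split; lra.
have Fc : cauchy F.
  apply: cauchy_exP => e e0.
  have e2 : 0 < e ^+ 2 / 8 by rewrite divr_gt0 ?exprn_gt0//; lra.
  have [z Bz] := Bne _ e2; exists z; exists (e ^+ 2 / 8) => // w Bw.
  rewrite -ball_normE /ball_/=.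
  rewrite -(@ltr_pXn2r _ 2)// ?nnegrE ?(ltW e0)//.
  apply: le_lt_trans (Bclose _ _ _ Bz Bw) _.
  by have := exprn_gt0 2 e0; lra.
have /cvg_ex [p Fp] : cvg F by exact: cauchy_cvg.
exists p; split.
  refine (@closed_cvg _ _ F FF idfun C Ccl _ p Fp).
  by exists 1 => //= z [].
move=> z Cz; rewrite -(@ler_pXn2r _ 2)// ?nnegrE//.
apply: le_trans (dle z Cz).
apply/ler_addgt0Pr => e e0.
have cF : (fun w => `|x - w| ^+ 2) @ F --> `|x - p| ^+ 2.
  have c1 : (fun w => `|x - w|) @ F --> `|x - p|.
    by apply: cvg_norm; apply: cvgB => //; exact: cvg_cst.
  by rewrite expr2; under eq_fun do rewrite expr2; exact: cvgM.
apply: (closed_cvg _ (@closed_le _ (d + e)) _ _ cF).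
by exists e => // w [_ /ltW].
Qed.

Lemma projP (C : set V) (x : V) : closed C -> convex_subset C -> C !=set0 ->
  C (proj C x) /\ forall z, C z -> `|x - proj C x| <= `|x - z|.
Proof. by move=> Ccl Cc C0; exact: (xgetPex 0 (proj_exists x Ccl Cc C0)). Qed.

End projection.

Definition submodule {R : realType} {V : lmodType R} (N : set V) :=
  N 0 /\ forall (a : R) x y, N x -> N y -> N (a *: x + y).

Section subspace_projection.
Context {R : realType} {V : hilbertType R} (N : set V).
Hypotheses (N_closed : closed N) (N_sub : submodule N).

Let NZ a x : N x -> N (a *: x).
Proof. by move=> Nx; rewrite -[_ *: _]addr0; apply: N_sub.2 => //; case: N_sub. Qed.

Let ND x y : N x -> N y -> N (x + y).
Proof. by move=> Nx Ny; rewrite -[x]scale1r; exact: N_sub.2. Qed.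

Let NN x : N x -> N (- x).
Proof. by move=> Nx; rewrite -scaleN1r; exact: NZ. Qed.

Let N_cvx : convex_subset N.
Proof. by move=> x y t Nx Ny _; apply: ND; exact: NZ. Qed.

Let N_ne : N !=set0. Proof. by exists 0; case: N_sub. Qed.

Lemma proj_in x : N (proj N x).
Proof. by case: (projP x N_closed N_cvx N_ne). Qed.

Lemma proj_orth x z : N z -> inner (x - proj N x) z = 0.
Proof.
move=> Nz; have [Np pmin] := projP x N_closed N_cvx N_ne.
set p := proj N x in Np pmin *; set w := x - p; set c := inner w z.
have [z0|z0] := eqVneq z 0; first by rewrite /c z0 inner0r.
have zp : 0 < inner z z by rewrite innerxx exprn_gt0// normr_gt0.
have Nq : N (p + (c / inner z z) *: z) by apply: ND => //; exact: NZ.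
have := pmin _ Nq; rewrite -(@ler_pXn2r _ 2)// ?nnegrE//.
rewrite opprD addrA -/w; clearbody w.
rewrite -!innerxx !innerE (innerC z w) -/c => h.
have : c ^+ 2 / inner z z <= 0.
  have e : c / inner z z * (c / inner z z * inner z z) = c ^+ 2 / inner z z.
    by field; rewrite gt_eqF.
  have e' : c / inner z z * c = c ^+ 2 / inner z z by field; rewrite gt_eqF.
  by move: h; lra.
rewrite pmulr_lle0 ?invr_gt0// => c2.
by apply/eqP; rewrite -sqrf_eq0 eq_le c2 sqr_ge0.
Qed.

Lemma proj_unique x p : N p -> (forall z, N z -> inner (x - p) z = 0) ->
  proj N x = p.
Proof.
move=> Np op; apply/eqP; rewrite -subr_eq0; apply/eqP/inner_eq0.
have Nd : N (proj N x - p) by apply: ND; [exact: proj_in|exact: NN].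
have := op _ Nd; have := proj_orth x Nd.
have -> : inner (proj N x - p) (proj N x - p) =
   inner (x - p) (proj N x - p) - inner (x - proj N x) (proj N x - p).
  by rewrite !innerE (innerC p); ring.
by move=> -> ->; rewrite subr0.
Qed.

Lemma projD x y : proj N (x + y) = proj N x + proj N y.
Proof.
apply: proj_unique; first by apply: ND; exact: proj_in.
by move=> z Nz; rewrite opprD addrACA innerDl !proj_orth// addr0.
Qed.

Lemma projZ a x : proj N (a *: x) = a *: proj N x.
Proof.
apply: proj_unique; first by apply: NZ; exact: proj_in.
by move=> z Nz; rewrite -scalerBr innerZl proj_orth// mulr0.
Qed.

Lemma inner_proj x y : inner x (proj N y) = inner (proj N x) (proj N y).
Proof.
have /eqP := proj_orth x (proj_in y).
by rewrite innerDl innerNl subr_eq0 => /eqP.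
Qed.

Lemma proj_id x : N x -> proj N x = x.
Proof.
by move=> Nx; apply: proj_unique => // z Nz; rewrite subrr inner0l.
Qed.

End subspace_projection.

Definition bounded_operator {R : realType} {V W : normedModType R}
  (T : V -> W) := exists M : R, forall x, `|T x| <= M * `|x|.

Definition opnorm {R : realType} {V W : normedModType R} (T : V -> W) : R :=
  sup [set `|T x| | x in [set x | `|x| <= 1]].

Section adjoint.
Context {R : realType} {H K : hilbertType R}.

(* For T linear and bounded, the set has exactly one element (Riesz). *)
Definition adjoint (T : H -> K) (y : K) : H :=
  xget 0 [set z | forall x, inner (T x) y = inner x z].

(* For T linear and bounded with closed range, the set has exactly one
   element. *)
Definition moore_penrose (T : H -> K) (y : K) : H :=
  xget 0 ([set x | adjoint T (T x) = adjoint T y] `&` range (adjoint T)).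

End adjoint.

Section operator_theory.
Context {R : realType} {H K : hilbertType R} (T : {linear H -> K}).
Hypothesis T_bounded : bounded_operator T.

Lemma bounded_operator_continuous : continuous T.
Proof.
case: T_bounded => M TM; apply: bounded_linear_continuous.
apply/linear_boundedP; near=> r => x; apply: le_trans (TM x) _.
by rewrite ler_wpM2r//; near: r; apply: nbhs_pinfty_ge; exact: num_real.
Unshelve. all: by end_near. Qed.

Lemma adjointP x y : inner (T x) y = inner x (adjoint T y).
Proof.
suff : exists z, forall u, inner (T u) y = inner u z by move=> /(xgetPex 0)->.
pose N := [set u | inner (T u) y = 0].
have N_sub : submodule N.
  split; first by rewrite /N /= linear0 inner0l.
  by move=> a u v; rewrite /N /= linearP innerDl innerZl => -> ->; rewrite mulr0 addr0.
have N_cl : closed N.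
  apply: (@preimage_closed _ _ (fun u => inner (T u) y) [set (0 : R)]); last first.
    exact/accessible_closed_set1/hausdorff_accessible/norm_hausdorff.
  move=> u _; apply/cvgrPdist_lt => e e0.
  have y1 : 0 < `|y| + 1 by rewrite ltr_wpDl.
  have := bounded_operator_continuous (x := u).
  move=> /cvgrPdist_lt /(_ (e / (`|y| + 1))); rewrite divr_gt0// => /(_ isT).
  apply: filterS => v; rewrite ltr_pdivlMr//; apply: le_lt_trans.
  rewrite -innerNl -innerDl; apply: le_trans (cauchy_schwarz _ _) _.
  by rewrite ler_wpM2l// lerDl.
have [Nall|/existsNP[u Nu]] := pselect (forall u, N u).
  by exists 0 => u; rewrite inner0r; exact: Nall.
pose w := u - proj N u.
have Tw : inner (T w) y = inner (T u) y.
  have := proj_in N_cl N_sub u; rewrite /N /= => h.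
  by rewrite /w linearB innerDl innerNl h subr0.
have Tw0 : inner (T w) y != 0 by rewrite Tw; exact/eqP.
have w0 : inner w w != 0.
  by apply: contra_neq Tw0 => /inner_eq0 ->; rewrite linear0 inner0l.
exists ((inner (T w) y / inner w w) *: w) => v.
have Nv : N (v - (inner (T v) y / inner (T w) y) *: w).
  by rewrite /N /= linearB linearZ innerDl innerNl innerZl divfK// subrr.
have := proj_orth N_cl N_sub u Nv; rewrite -/w; clearbody w.
rewrite innerDr innerNr innerZr innerZr (innerC w v) => /eqP.
by rewrite subr_eq0 => /eqP ->; field; apply/andP.
Qed.

Lemma kernel_submodule : submodule (kernel T).
Proof.
split; first by rewrite /kernel /= linear0.
by move=> a x y; rewrite /kernel /= linearP => -> ->; rewrite scaler0 addr0.
Qed.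

Lemma kernel_closed : closed (kernel T).
Proof.
apply: (@preimage_closed _ _ T [set (0 : K)]).
  by move=> x _; exact: bounded_operator_continuous.
exact/accessible_closed_set1/hausdorff_accessible/norm_hausdorff.
Qed.

Lemma operator_neq0 : (T : H -> K) <> cst 0 -> exists x, T x != 0.
Proof.
move=> T0; apply/not_existsP => h; apply: T0; apply/funext => x /=.
by apply/eqP/negbNE/negP; exact: h.
Qed.

Lemma opnorm_gt0 : (T : H -> K) <> cst 0 -> 0 < opnorm T.
Proof.
move=> /operator_neq0 [x Tx]; case: T_bounded => M TM.
have x0 : x != 0 by apply: contra_neq Tx => ->; rewrite linear0.
have xp : 0 < `|x| by rewrite normr_gt0.
apply: (@lt_le_trans _ _ `|T (`|x|^-1 *: x)|).
  by rewrite normr_gt0 linearZ scaler_eq0 negb_or Tx invr_eq0 gt_eqF.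
apply: ub_le_sup.
  exists `|M| => _ [z /= z1 <-]; apply: le_trans (TM z) _.
  rewrite (le_trans (ler_wpM2r _ (ler_norm M)))//.
  by rewrite -[leRHS]mulr1 ler_wpM2l.
exists (`|x|^-1 *: x) => //=.
by rewrite normrZ ger0_norm ?invr_ge0// mulVf ?gt_eqF.
Qed.

End operator_theory.

(* H_T: a copy of H, made below a Hilbert space for weighted_form T, which
   requires the hypotheses on T. *)
Definition weighted_space {R : realType} {H K : hilbertType R}
    (T : {linear H -> K}) of bounded_operator T & (T : H -> K) <> cst 0
    & closed (range T) : Type := H.

Definition weighted_form {R : realType} {H K : hilbertType R}
    (T : {linear H -> K}) (x y : H) : R :=
  inner (T x) (T y) / opnorm T ^+ 2 + inner x (proj (kernel T) y).

Section weighted_space.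
Context {R : realType} {H K : hilbertType R} (T : {linear H -> K}).
Hypotheses (T_bounded : bounded_operator T) (T_neq0 : (T : H -> K) <> cst 0).
Hypothesis T_closed : closed (range T).

Let Kcl := kernel_closed T_bounded.
Let Ksub := kernel_submodule T.
Let P := proj (kernel T).
Let c := opnorm T.
Let c0 : 0 < c. Proof. exact: opnorm_gt0. Qed.
Let c2 : 0 < c ^+ 2. Proof. exact: exprn_gt0. Qed.

Let formE x y : weighted_form T x y = inner (T x) (T y) / c ^+ 2 + inner (P x) (P y).
Proof. by rewrite /weighted_form (inner_proj Kcl Ksub). Qed.

Let fC x y : weighted_form T x y = weighted_form T y x.
Proof. by rewrite !formE innerC [X in _ + X]innerC. Qed.

Let fDl x y z : weighted_form T (x + y) z = weighted_form T x z + weighted_form T y z.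
Proof. by rewrite /weighted_form linearD !innerDl mulrDl addrACA. Qed.

Let fZl a x y : weighted_form T (a *: x) y = a * weighted_form T x y.
Proof. by rewrite /weighted_form linearZ !innerZl mulrDr mulrA. Qed.

Let formxx x : weighted_form T x x = `|T x| ^+ 2 / c ^+ 2 + `|P x| ^+ 2.
Proof. by rewrite formE !innerxx. Qed.

Let f_ge0 x : 0 <= weighted_form T x x.
Proof. by rewrite formxx addr_ge0 ?divr_ge0 ?sqr_ge0. Qed.

Let f_eq0 x : weighted_form T x x = 0 -> x = 0.
Proof.
rewrite formxx => /eqP; rewrite paddr_eq0 ?divr_ge0 ?sqr_ge0//.
rewrite mulf_eq0 invr_eq0 (gt_eqF c2) orbF !expf_eq0/= !normr_eq0.
case/andP => /eqP Tx /eqP; rewrite /P (proj_id Kcl Ksub)//.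
Qed.

Local Notation HT := (weighted_space T_bounded T_neq0 T_closed).

HB.instance Definition _ := GRing.Lmodule.copy HT H.
HB.instance Definition _ := Lmodule_hasInner.Build R HT fC fDl fZl f_ge0 f_eq0.

Let normHT (x : HT) : `|x| ^+ 2 = `|T x| ^+ 2 / c ^+ 2 + `|P x| ^+ 2.
Proof. by rewrite -innerxx -formxx. Qed.

Let T_le (x : HT) : `|T x| <= c * `|x|.
Proof.
rewrite -(@ler_pXn2r _ 2)// ?nnegrE ?mulr_ge0 ?(ltW c0)//.
by rewrite exprMn mulrC -ler_pdivrMr// normHT lerDl sqr_ge0.
Qed.

Let P_le (x : HT) : `|P x| <= `|x|.
Proof.
rewrite -(@ler_pXn2r _ 2)// ?nnegrE//.
by rewrite normHT lerDr divr_ge0// sqr_ge0.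
Qed.

Let le_HT (x : HT) : `|x| <= `|T x| / c + `|P x|.
Proof.
rewrite -(@ler_pXn2r _ 2)// ?nnegrE ?addr_ge0 ?divr_ge0 ?(ltW c0)//.
rewrite normHT sqrrD expr_div_n lerD2r lerDl.
by rewrite mulrn_wge0// mulr_ge0// divr_ge0// ltW.
Qed.

Let PB (x y : H) : P (x - y) = P x - P y.
Proof. by rewrite -scaleN1r /P projD// projZ// scaleN1r. Qed.

Let HT_complete (F : set_system HT) : ProperFilter F -> cauchy F -> cvg F.
Proof.
move=> FF /cauchy_ballP Fc.
have Tc : cauchy (T @ (F : set_system H)).
  apply/cauchy_ballP => e e0; near_simpl.
  have ec : 0 < e / c by rewrite divr_gt0.
  apply: filterS (Fc _ ec) => -[x y] /=.
  rewrite -!ball_normE /ball_/= => xy; rewrite -linearB.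
  by apply: le_lt_trans (T_le (x - y)) _; rewrite mulrC -ltr_pdivlMr.
have Pc : cauchy (P @ (F : set_system H)).
  apply/cauchy_ballP => e e0; near_simpl.
  apply: filterS (Fc _ e0) => -[x y] /=.
  rewrite -!ball_normE /ball_/= => xy; rewrite -PB.
  exact: le_lt_trans (P_le (x - y)) _.
have /cvg_ex [k Tk] : cvg (T @ (F : set_system H)) by exact: cauchy_cvg.
have /cvg_ex [p Pp] : cvg (P @ (F : set_system H)) by exact: cauchy_cvg.
have [u _ uk] : range T k.
  apply: (closed_cvg (range T) T_closed _ _ Tk).
  by apply: nearW => x; exists x.
have Np : kernel T p.
  apply: (closed_cvg (kernel T) Kcl _ _ Pp).
  by apply: nearW => x; exact: proj_in.
have Nu : kernel T (P u) by exact: proj_in.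
pose l : HT := u - P u + p.
have Tl : T l = k by rewrite /l linearD linearB Np Nu subr0 addr0.
have Pl : P l = p.
  transitivity (P (u - P u) + P p); first exact: projD.
  have PPu : P (P u) = P u by exact: proj_id.
  have PPp : P p = p by exact: proj_id.
  by rewrite PB PPu PPp subrr add0r.
apply/cvg_ex; exists l.
apply/cvgrPdist_lt => e e0.
have ec : 0 < e / 2 * c by rewrite mulr_gt0// divr_gt0.
have e2 : 0 < e / 2 by rewrite divr_gt0.
move/cvgrPdist_lt : Tk => /(_ _ ec) Tk.
move/cvgrPdist_lt : Pp => /(_ _ e2) Pp.
near=> x; apply: le_lt_trans (le_HT (l - x)) _.
rewrite linearB PB Tl Pl [ltRHS](splitr e) ltrD//.
  by rewrite ltr_pdivrMr//; near: x.
by near: x.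
Unshelve. all: by end_near. Qed.

HB.instance Definition _ := Uniform_isComplete.Build HT HT_complete.

Lemma weighted_innerE (x y : HT) : inner x y =
  inner (T x) (T y) / opnorm T ^+ 2 + inner (x : H) (proj (kernel T) (y : H)).
Proof. by []. Qed.

End weighted_space.

(* argmin_y (|x - y|^2 / 2 + f y), as a set. *)
Definition prox_set {R : realType} {X : hilbertType R} (f : X -> \bar R)
    (x : X) : set X :=
  [set p | forall y, ((2^-1 * `|x - p| ^+ 2)%:E + f p <=
                      (2^-1 * `|x - y| ^+ 2)%:E + f y)%E].

Definition Gamma0 {R : realType} {X : hilbertType R} : set (X -> \bar R) :=
  [set f | [/\ (forall x, f x != -oo%E), (exists x, f x != +oo%E),
    (forall x y (t : R), 0 < t < 1 ->
      (f (t *: x + (1 - t) *: y)%R <= t%:E * f x + (1 - t)%:E * f y)%E) &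
    lower_semicontinuous f]].

Definition is_prox {R : realType} {X : hilbertType R} (f : X -> \bar R)
    (P : X -> X) := forall x, prox_set f x = [set P x].

Definition proximity_operator {R : realType} {X : hilbertType R} (P : X -> X) :=
  exists2 f : X -> \bar R, Gamma0 f & is_prox f P.

(* Main.v *)
Require Import Defs.
From HB Require Import structures.
From mathcomp Require Import all_boot all_order all_algebra.
From mathcomp Require Import boolp classical_sets functions reals
  constructive_ereal topology normedtype.
From mathcomp Require Import ring lra ereal sequences.

Set Implicit Arguments.
Unset Strict Implicit.
Unset Printing Implicit Defensive.

Import Order.TTheory GRing.Theory Num.Theory.
Import numFieldNormedType.Exports.

Local Open Scope classical_set_scope.
Local Open Scope ring_scope.

(** Why the theorem holds.

    A map [A] on a Hilbert space is a proximity operator as soon as there is a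
    real function [k] with [k x + <x - A x, A z - A x> <= k z] for all [x], [z]
    ([proximity_operator_potential]).  Indeed the supremum [f] over [x] of the
    affine functions [u |-> k x + <x - A x, u - A x>] is convex and lower
    semicontinuous, satisfies [f (A x) = k x], and has [x - A x] as a
    subgradient at [A x], which is the optimality condition of the strongly
    convex problem defining [prox_f x].  Conversely, for [A = prox_g] the
    function [k = g \o A] has this property ([prox_subgradient]).  Working with
    [k] avoids the marginal function of [g] that would otherwise describe the
    new operator, together with the question of its lower semicontinuity.

    Let [V = range T] and let [P] be the orthogonal projection onto [V].  The
    property passes from [prox_g] to the compression [v |-> P (prox_g (v + b))]
    on [V]: adding [- <b, .> + |. - P .|^2 / 2] to [g] accounts for the
    translation by [b] and for the component orthogonal to [V]
    ([compressed_prox_potential]).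

    Finally [T (T^dagger y) = P y] and [T^dagger y] is orthogonal to the kernel
    of [T].  Hence in the inner product of the weighted space the pairing of
    [x - A x] with [A z - A x] is the one of [T x - P y_x] with [P y_z - P y_x]
    in [K], divided by [|T|^2], where [y_x = prox_g (T x + b)]; so the potential
    on [V], divided by [|T|^2], is a potential for [A].

    These two facts on [T^dagger] presuppose that the set defining it is
    nonempty, that is, that every vector orthogonal to the kernel lies in the
    range of the adjoint ([kernel_orth_range_adjoint]).  This is the closed
    range theorem; it follows from the uniform boundedness principle, which
    gives [|y| <= M |T^* y|] on [V] ([adjoint_bounded_below]). *)

(** * Subgradients and proximity operators *)

Lemma prox_fin_num (R : realType) (X : hilbertType R) (f : X -> \bar R)
    (A : X -> X) x : Gamma0 f -> is_prox f A -> f (A x) \is a fin_num.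
Proof.
move=> [fNy [y fy] _ _] fA; rewrite fin_numE fNy /=.
have : prox_set f x (A x) by rewrite fA.
move=> /(_ y); case: (f (A x)) => //; rewrite addey// leye_eq.
by case: (f y) fy => [r| |]//.
Qed.

(** Fermat's rule: [x - A x] is a subgradient of [f] at [A x].  Comparing [A x]
    with the points [t *: y + (1 - t) *: A x], the first-order term in [t] of the
    quadratic part must be compensated by convexity of [f]. *)
Lemma prox_subgradient (R : realType) (X : hilbertType R) (f : X -> \bar R)
    (A : X -> X) x y : Gamma0 f -> is_prox f A ->
  (f (A x) + (inner (x - A x) (y - A x))%:E <= f y)%E.
Proof.
move=> fG fA; have [fNy _ f_cvx _] := fG.
have := prox_fin_num x fG fA; have : prox_set f x (A x) by rewrite fA.
set p := A x => p_min; case Es : (f p) => [s| |]// _.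
case Er : (f y) => [r| |]; [|by rewrite leey|by have := fNy y; rewrite Er].
rewrite -EFinD lee_fin leNgt; apply/negP => gap.
set w := x - p in gap *; set d := y - p in gap *.
set D := inner d d; have D0 : 0 <= D by exact: inner_ge0.
set a := s + inner w d - r; have a0 : 0 < a by rewrite /a subr_gt0.
have E0 : 0 < a + 1 + D by lra.
(* The gap [a] would give [a <= t * D / 2] for every [t] in ]0, 1[; this [t]
   contradicts it. *)
pose t := a / (a + 1 + D).
have t0 : 0 < t by rewrite divr_gt0.
have t1 : t < 1 by rewrite ltr_pdivrMr//; lra.
have tD : t * (a + 1 + D) = a by rewrite divfK// gt_eqF.
have := f_cvx y p t; rewrite t0 t1 => /(_ isT).
have := p_min (t *: y + (1 - t) *: p); rewrite Es Er.
have -> : x - (t *: y + (1 - t) *: p) = w - t *: d.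
  by rewrite /w /d scalerBl scale1r scalerBr [t *: y + _]addrCA opprD addrA.
case: (f _) => [q| |]//; rewrite -?EFinM -?EFinD ?lee_fin.
rewrite -/w; clearbody w d; rewrite -!innerxx !innerE (innerC d w) -/D.
move=> h1 h2.
have : t * a <= t * (t * D / 2) by move: h1 h2; rewrite /a; lra.
rewrite ler_pM2l// => h3.
have : 0 < t * a by exact: mulr_gt0.
by move: h3 tD; nra.
Qed.

(** The supremum [f] of the affine functions through [(A x, k x)] with slope
    [x - A x] interpolates [k] along [A] thanks to the hypothesis, which is a
    form of cyclic monotonicity.  Each affine minorant, added to the quadratic
    term, yields at [u] the minimal value plus [|u - A x|^2 / 2]; this proves
    minimality of [A x] and its uniqueness at once. *)
Lemma proximity_operator_potential (R : realType) (X : hilbertType R)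
    (A : X -> X) (k : X -> R) :
  (forall x z, k x + inner (x - A x) (A z - A x) <= k z) ->
  proximity_operator A.
Proof.
move=> kA.
pose m x u := k x + inner (x - A x) (u - A x).
pose f u := ereal_sup [set (m x u)%:E | x in [set: X]].
have m_le_f x u : ((m x u)%:E <= f u)%E.
  by apply: ereal_sup_ubound; exists x.
have fA x : f (A x) = (k x)%:E.
  apply/eqP; rewrite eq_le; apply/andP; split.
    by apply: ge_ereal_sup => _ [z _ <-]; rewrite lee_fin; exact: kA.
  by have := m_le_f x (A x); rewrite /m subrr inner0r addr0.
have m_le x u : ((2^-1 * `|x - A x| ^+ 2 + k x + 2^-1 * `|u - A x| ^+ 2)%:E <=
                 (2^-1 * `|x - u| ^+ 2)%:E + f u)%E.
  apply: le_trans (leeD2l _ (m_le_f x u)).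
  rewrite -EFinD lee_fin le_eqVlt; apply/orP; left; apply/eqP.
  rewrite /m; have -> : x - u = (x - A x) - (u - A x) by rewrite opprB addrA subrK.
  set w := x - A x; set d := u - A x; clearbody w d.
  by rewrite -!innerxx !innerE (innerC d w); field.
exists f; first split.
- by move=> u; rewrite gt_eqF// (lt_le_trans _ (m_le_f 0 u))// ltNyr.
- by exists (A 0); rewrite fA.
- move=> u v t /andP[t0 t1].
  apply: ge_ereal_sup => _ [x _ <-].
  have -> : m x (t *: u + (1 - t) *: v) = t * m x u + (1 - t) * m x v.
    by rewrite /m !innerE; ring.
  rewrite EFinD !EFinM leeD// lee_pmul2l// lte_fin subr_gt0//.
- move=> u a /ereal_sup_gt [_ [x _ <-]]; rewrite lte_fin => ax.
  pose B := `|x - A x| + 1.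
  have B0 : 0 < B by rewrite ltr_wpDl.
  exists (ball u ((m x u - a) / B)).
    by apply: nbhsx_ballx; rewrite divr_gt0// subr_gt0.
  move=> v; rewrite -ball_normE /= ltr_pdivlMr// => uv.
  apply: lt_le_trans (m_le_f x v); rewrite lte_fin.
  have -> : m x v = m x u - inner (x - A x) (u - v).
    by rewrite /m !innerE; ring.
  have := cauchy_schwarz (x - A x) (u - v).
  have : `|x - A x| * `|u - v| <= `|u - v| * B.
    by rewrite mulrC ler_wpM2l// lerDl.
  have := ler_norm (inner (x - A x) (u - v)).
  by move: uv; lra.
move=> x; apply/seteqP; split => [p|_ ->] /=.
  move=> /(_ (A x)) pA; have := le_trans (m_le x p) pA.
  rewrite fA -EFinD lee_fin => h; apply/eqP; rewrite -subr_eq0 -normr_eq0 -sqrf_eq0.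
  by rewrite eq_le sqr_ge0 andbT; move: h; lra.
move=> u; rewrite fA -EFinD; apply: le_trans (m_le x u).
by rewrite lee_fin lerDl mulr_ge0.
Qed.

(** The function [k] below is the value at [Prox (v + b)] of
    [y |-> g y - <b, y> + |y - P y|^2 / 2], where [P] projects onto [V].  With
    [y_v = Prox (v + b)] and [w_v = y_v - P y_v], the subgradient inequality of
    [g] between [y_v] and [y_z] leaves, after splitting along [V], the term
    [<w_v, w_z - w_v>], which is at most [|w_z|^2 / 2 - |w_v|^2 / 2]. *)
Lemma compressed_prox_potential (R : realType) (K : hilbertType R) (V : set K)
    (b : K) (Prox : K -> K) :
  closed V -> submodule V -> proximity_operator Prox ->
  exists k : K -> R, forall v z, V v ->
    k v + inner (v - proj V (Prox (v + b)))
                (proj V (Prox (z + b)) - proj V (Prox (v + b))) <= k z.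
Proof.
move=> Vcl Vsub [g gG gProx].
pose y v := Prox (v + b); pose p v := proj V (y v).
exists (fun v => fine (g (y v)) - inner b (y v) + 2^-1 * `|y v - p v| ^+ 2).
move=> v z Vv; have := prox_subgradient (v + b) (y z) gG gProx.
rewrite -/(y v) -(fineK (prox_fin_num (v + b) gG gProx)).
rewrite -(fineK (prox_fin_num (z + b) gG gProx)) -EFinD lee_fin.
rewrite -/(y v) -/(y z) -/(p v) -/(p z) => gyz.
have orth u q : V q -> inner (y u - p u) q = 0.
  by move=> Vq; exact: proj_orth.
have Vp u : V (p u) by exact: proj_in.
have o1 := orth v _ (Vp v); have o2 := orth v _ (Vp z).
have o3 := orth z _ (Vp v); have o4 := orth z _ (Vp z).
have o5 := orth v _ Vv; have o6 := orth z _ Vv.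
have := inner_ge0 ((y z - p z) - (y v - p v)).
move: gyz o1 o2 o3 o4 o5 o6; rewrite -!innerxx.
move: (y v) (y z) (p v) (p z) => yv yz pv pz.
rewrite !innerE (innerC yz yv) (innerC pv yv) (innerC pz yv) (innerC pv yz).
rewrite (innerC pz yz) (innerC pz pv) (innerC v yv) (innerC v yz).
rewrite (innerC v pv) (innerC v pz).
by lra.
Qed.

(** * Operators with closed range and their Moore-Penrose inverse *)

Section closed_range.
Context (R : realType) (H K : hilbertType R) (T : {linear H -> K}).
Hypotheses (T_bounded : bounded_operator T) (T_closed : closed (range T)).

Lemma range_submodule : submodule (range T).
Proof.
split; first by exists 0 => //; rewrite linear0.
by move=> a _ _ [u _ <-] [v _ <-]; exists (a *: u + v) => //; rewrite linearP.
Qed.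

Lemma adjoint_unique y z : (forall x, inner (T x) y = inner x z) ->
  adjoint T y = z.
Proof.
move=> yz; apply/eqP; rewrite -subr_eq0; apply/eqP/inner_eq0.
by rewrite innerDr innerNr -(adjointP T_bounded) yz subrr.
Qed.

Lemma adjoint_linear : linear (adjoint T).
Proof.
move=> a y z; apply: adjoint_unique => x.
by rewrite !innerE !(adjointP T_bounded).
Qed.

Lemma adjoint_proj_range y : adjoint T (proj (range T) y) = adjoint T y.
Proof.
apply: adjoint_unique => x; rewrite -(adjointP T_bounded).
have /eqP := proj_orth T_closed range_submodule y (imageT T x).
by rewrite innerDl innerNl subr_eq0 innerC => /eqP ->; rewrite innerC.
Qed.

(** Uniform boundedness on [K] for the functionals [k |-> <y, k>] with [y] in the
    range of [T] and [|T^* y| <= 1].  They are pointwise bounded: writing the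
    projection of [k] onto the range as [T u], one has
    [<y, k> = <y, T u> = <T^* y, u>], of absolute value at most [|u|]. *)
Lemma adjoint_bounded_below :
  exists M, forall y, range T y -> `|y| <= M * `|adjoint T y|.
Proof.
pose F := [set inner y | y in [set y | range T y /\ `|adjoint T y| <= 1]]
  : set (K -> R).
have F_lin f : F f -> bounded_fun_norm f /\ linear (f : K -> R^o).
  move=> [y _ <-]; split; last by move=> a u v; rewrite !innerE.
  move=> r; exists (`|y| * r) => x xr.
  by apply: le_trans (cauchy_schwarz _ _) _; rewrite ler_wpM2l.
have F_ptw : pointwise_bounded F.
  move=> k; have [u _ uk] := proj_in T_closed range_submodule k.
  exists `|u| => _ [y [Ty y1] <-].
  have /eqP := proj_orth T_closed range_submodule k Ty.
  rewrite innerDl innerNl subr_eq0 => /eqP e.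
  rewrite innerC e -uk (adjointP T_bounded).
  by apply: le_trans (cauchy_schwarz _ _) _; rewrite -[leRHS]mulr1 ler_wpM2l.
have [M FM] := @Banach_Steinhauss R K R^o F F_lin F_ptw 1.
exists M => y Ty.
have [t0|t0] := eqVneq (adjoint T y) 0.
  have [u _ uy] := Ty; rewrite t0 normr0 mulr0 normr_le0; apply/eqP.
  by apply: inner_eq0; rewrite -{1}uy (adjointP T_bounded) t0 inner0r.
have tp : 0 < `|adjoint T y| by rewrite normr_gt0.
have y0 : y != 0.
  apply: contra_neq t0 => ->; apply: adjoint_unique => x.
  by rewrite !inner0r.
have yp : 0 < `|y| by rewrite normr_gt0.
have := FM (inner (`|adjoint T y|^-1 *: y)) _ (`|y|^-1 *: y).
rewrite normrZ normfV normr_id mulVf ?gt_eqF// => /(_ _ (lexx _)).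
rewrite innerZl innerZr innerxx expr2 mulKf ?gt_eqF// mulrC.
rewrite ger0_norm ?divr_ge0// ler_pdivrMr//; apply.
exists (`|adjoint T y|^-1 *: y) => //; split.
  have [u _ <-] := Ty; exists (`|adjoint T (T u)|^-1 *: u) => //.
  by rewrite linearZ.
have -> : adjoint T (`|adjoint T y|^-1 *: y) = `|adjoint T y|^-1 *: adjoint T y.
  by apply: adjoint_unique => x; rewrite !innerZr (adjointP T_bounded).
by rewrite normrZ normfV normr_id mulVf ?gt_eqF.
Qed.

Lemma adjoint_bounded : bounded_operator (adjoint T).
Proof.
have [M TM] := T_bounded; exists `|M| => y.
have [-> |y0] := eqVneq (adjoint T y) 0; first by rewrite normr0 mulr_ge0.
have yp : 0 < `|adjoint T y| by rewrite normr_gt0.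
rewrite -(ler_pM2l yp) -expr2 -innerxx -(adjointP T_bounded).
apply: le_trans (ler_norm _) _; apply: le_trans (cauchy_schwarz _ _) _.
rewrite mulrA ler_wpM2r// mulrC; apply: le_trans (TM _) _.
by rewrite ler_wpM2r// ler_norm.
Qed.

Let adjointT : {linear K -> H} :=
  HB.pack (adjoint T) (GRing.isLinear.Build _ _ _ _ _ adjoint_linear).

(** Near a limit point [z] of the range of [T^*], preimages under [T^*] may be
    chosen in the range of [T], since [T^*] vanishes on its orthogonal
    complement; there the lower bound on [T^*] makes them Cauchy. *)
Lemma closed_range_adjoint : closed (range (adjoint T)).
Proof.
have [M yM] := adjoint_bounded_below.
move=> z zcl.
pose B (e : R) := [set y | range T y /\ `|z - adjoint T y| < e].
have Bne e : 0 < e -> B e !=set0.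
  move=> e0; have := zcl (ball z e) (nbhsx_ballx _ _ e0).
  move=> [_ [[y _ <-]]]; rewrite -ball_normE /= => ye.
  exists (proj (range T) y); split; last by rewrite adjoint_proj_range.
  exact: proj_in T_closed range_submodule y.
pose F := filter_from [set e : R | 0 < e] B.
have FF : ProperFilter F.
  apply: filter_from_proper; last exact: Bne.
  apply: filter_from_filter; first by exists 1 => /=.
  move=> a c /= a0 c0; exists (Num.min a c); first by rewrite lt_min a0.
  by move=> y [Ty]; rewrite lt_min => /andP[]; split; split.
have Fc : cauchy F.
  apply: cauchy_exP => e e0.
  have M0 : 0 < 1 + `|M| by rewrite ltr_pwDl.
  have d0 : 0 < e / 2 / (1 + `|M|) by rewrite !divr_gt0.
  have [y [Ty yz]] := Bne _ d0; exists y, (e / 2 / (1 + `|M|)) => // w [Tw wz].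
  rewrite -ball_normE /=.
  have Tyw : range T (y - w).
    have := range_submodule.2 (-1) w y Tw Ty.
    by rewrite scaleN1r addrC.
  apply: le_lt_trans (yM _ Tyw) _.
  have -> : adjoint T (y - w) = (z - adjoint T w) - (z - adjoint T y).
    have -> : adjoint T (y - w) = adjoint T y - adjoint T w.
      exact: (linearB adjointT).
    by rewrite opprB [RHS]addrC subrKA.
  have h := ler_normB (z - adjoint T w) (z - adjoint T y).
  have {}h : `|z - adjoint T w - (z - adjoint T y)| < e / (1 + `|M|).
    apply: le_lt_trans h _; rewrite (splitr e) mulrDl ltrD//.
  apply: (@le_lt_trans _ _ (`|M| * (e / (1 + `|M|)))).
    apply: (@le_trans _ _ (`|M| * `|z - adjoint T w - (z - adjoint T y)|)).
      by rewrite ler_wpM2r// ler_norm.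
    by rewrite ler_wpM2l// ltW.
  by rewrite mulrCA gtr_pMr// ltr_pdivrMr// mul1r ltrDr.
have /cvg_ex [y Fy] : cvg F by exact: cauchy_cvg.
exists y => //.
apply: (@cvg_unique _ (@norm_hausdorff _ _) (adjoint T @ F)).
  apply: cvg_trans (cvg_app (adjoint T) Fy) _.
  exact: (@bounded_operator_continuous _ _ _ adjointT adjoint_bounded y).
apply/cvgrPdist_lt => e e0; near_simpl.
by exists e => // w [].
Qed.

(** The residual of the projection of [x] onto the range of [T^*] is orthogonal
    to that range, hence in the kernel of [T], to which [x] and the range of
    [T^*] are both orthogonal. *)
Lemma kernel_orth_range_adjoint x :
  (forall u, kernel T u -> inner x u = 0) -> range (adjoint T) x.
Proof.
move=> xN; have sub : submodule (range (adjoint T)).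
  split; first by exists 0 => //; exact: (linear0 adjointT).
  move=> a _ _ [u _ <-] [v _ <-]; exists (a *: u + v) => //.
  exact: (linearP adjointT).
have := proj_in closed_range_adjoint sub x.
have := proj_orth closed_range_adjoint sub x.
set p := proj _ x => porth [k _ kp]; suff -> : x = p by exists k.
apply/eqP; rewrite -subr_eq0; apply/eqP; set w := x - p.
have Nw : kernel T w.
  apply: inner_eq0; rewrite (adjointP T_bounded); apply: porth.
  by exists (T w).
apply: inner_eq0; rewrite {1}/w innerDl innerNl xN// sub0r -kp.
by rewrite innerC -(adjointP T_bounded) Nw inner0l oppr0.
Qed.

(** Nonemptiness of the set from which [moore_penrose] picks: if [T u] is the
    projection of [y] onto the range of [T], then removing from [u] its
    component in the kernel of [T] gives an element. *)
Lemma moore_penroseP y :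
  adjoint T (T (moore_penrose T y)) = adjoint T y /\
  range (adjoint T) (moore_penrose T y).
Proof.
apply: (@xgetPex _ 0 ([set x | adjoint T (T x) = adjoint T y] `&`
  range (adjoint T))).
have [u _ uy] := proj_in T_closed range_submodule y.
have Ncl := kernel_closed T_bounded; have Nsub := kernel_submodule T.
exists (u - proj (kernel T) u); split => /=.
  have := proj_in Ncl Nsub u; rewrite /kernel /= => e.
  by rewrite linearB e subr0 uy adjoint_proj_range.
by apply: kernel_orth_range_adjoint => v; exact: proj_orth.
Qed.

Lemma moore_penrose_orth y u : kernel T u -> inner (moore_penrose T y) u = 0.
Proof.
have [_ [k _ <-]] := moore_penroseP y.
by rewrite innerC -(adjointP T_bounded) => ->; rewrite inner0l.
Qed.

Lemma range_moore_penrose y : T (moore_penrose T y) = proj (range T) y.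
Proof.
apply/esym/proj_unique => //; first exact: range_submodule.
move=> _ [u _ <-]; rewrite innerDl innerNl [X in X - _]innerC [X in _ - X]innerC.
by rewrite !(adjointP T_bounded) (moore_penroseP y).1 subrr.
Qed.

End closed_range.

(** * The proximity operator on the weighted space *)

Theorem theorem3p3 (R : realType) (H K : hilbertType R) (b : K)
    (T : {linear H -> K}) (T_bounded : bounded_operator T)
    (T_neq0 : (T : H -> K) <> cst 0) (T_closed : closed (range T))
    (Prox : K -> K) (Prox_prox : proximity_operator Prox) :
  proximity_operator
    (fun x : weighted_space T_bounded T_neq0 T_closed =>
       (moore_penrose T (Prox (T x + b)) :
          weighted_space T_bounded T_neq0 T_closed)).
Proof.
have [k k_subgrad] :=
  compressed_prox_potential b T_closed (range_submodule T) Prox_prox.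
have c2 : 0 < opnorm T ^+ 2 by rewrite exprn_gt0// opnorm_gt0.
(* The slopes live in the weighted space, whose form carries the factor
   [1 / opnorm T ^+ 2] on the part seen by [T]. *)
pose HT : hilbertType R := weighted_space T_bounded T_neq0 T_closed.
apply: (@proximity_operator_potential R HT _
  (fun x : HT => k (T x) / opnorm T ^+ 2)).
move=> x z; rewrite weighted_innerE.
set Ax : H := moore_penrose T (Prox (T x + b)).
set Az : H := moore_penrose T (Prox (T z + b)).
have -> : T ((x : H) - Ax) =
    T x - proj (range T) (Prox (T x + b)).
  by rewrite linearB range_moore_penrose.
have -> : T (Az - Ax) =
    proj (range T) (Prox (T z + b)) - proj (range T) (Prox (T x + b)).
  by rewrite linearB !range_moore_penrose.
have -> : proj (kernel T) (Az - Ax) = 0.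
  apply: proj_unique.
  - exact: kernel_closed.
  - exact: kernel_submodule.
  - by rewrite /kernel /= linear0.
  by move=> u Nu; rewrite subr0 innerDl innerNl !moore_penrose_orth// subrr.
rewrite inner0r addr0 -mulrDl ler_pM2r ?invr_gt0//.
by apply: k_subgrad; exists x.
Qed.
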